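(* Let $\mathbb{K}$ be a field of characteristic $0$, let $(A,\mu,\alpha)$ be a hom-associative algebra over $\mathbb{K}$ and let $M=(M,\mu,\alpha_M)$ be an $A$-bimodule. Then there is a bijection $$H^2_{\alpha,\alpha_M}(A,M)\;\cong\;\mathcal{E}xt(A,M)$$ between the second Hochschild-type cohomology of $A$ with coefficients in $M$ and the set of equivalence classes of abelian extensions of $A$ by $M$ for which the induced $A$-bimodule structure on $M$ is the given one.
   Context: All vector spaces are over a field $\mathbb{K}$ of characteristic $0$. Hom-associative algebra (always assumed multiplicative): a triple $(A,\mu,\alpha)$ of a vector space $A$, a bilinear map $\mu:A\times A\to A$ and a linear map $\alpha:A\to A$ with $\mu(\alpha(a),\mu(b,c))=\mu(\mu(a,b),\alpha(c))$ and $\alpha(\mu(a,b))=\mu(\alpha(a),\alpha(b))$ for all $a,b,c\in A$. A morphism of hom-associative algebras is a linear map commuting with the products and with the structure maps $\alpha$. $A$-bimodule: a vector space $M$ with a linear map $\alpha_M:M\to M$ and bilinear maps $A\otimes M\to M$ and $M\otimes A\to M$, both again denoted $\mu$, such that for all $a,b\in A$, $m\in M$: $\alpha_M(\mu(a,m))=\mu(\alpha(a),\alpha_M(m))$, $\mu(\alpha(a),\mu(b,m))=\mu(\mu(a,b),\alpha_M(m))$, $\alpha_M(\mu(m,a))=\mu(\alpha_M(m),\alpha(a))$, $\mu(\mu(m,a),\alpha(b))=\mu(\alpha_M(m),\mu(a,b))$, and $\mu(\alpha(a),\mu(m,b))=\mu(\mu(a,m),\alpha(b))$. Cohomology: for $n\ge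 1$, $C^n_{\alpha,\alpha_M}(A,M)$ is the space of multilinear maps $f:A^{\otimes n}\to M$ with $\alpha_M\circ f=f\circ\alpha^{\otimes n}$. The coboundary $\delta_\alpha:C^n_{\alpha,\alpha_M}(A,M)\to C^{n+1}_{\alpha,\alpha_M}(A,M)$ is $$(\delta_\alpha f)(a_1,\dots,a_{n+1})=\mu(\alpha^{n-1}(a_1),f(a_2,\dots,a_{n+1}))+\sum_{i=1}^n(-1)^i f(\alpha(a_1),\dots,\alpha(a_{i-1}),\mu(a_i,a_{i+1}),\alpha(a_{i+2}),\dots,\alpha(a_{n+1}))+(-1)^{n+1}\mu(f(a_1,\dots,a_n),\alpha^{n-1}(a_{n+1})),$$ and satisfies $\delta_\alpha^2=0$. For $n\ge 2$, $H^n_{\alpha,\alpha_M}(A,M)=\ker(\delta_\alpha|_{C^n})/\delta_\alpha(C^{n-1})$. Abelian extension of $A$ by $(M,\alpha_M)$: a short exact sequence of hom-associative algebras $0\to(M,0,\alpha_M)\xrightarrow{i}(E,\mu_E,\alpha_E)\xrightarrow{j}(A,\mu,\alpha)\to 0$ (where $M$ has zero multiplication) together with a linear section $s:A\to E$ of $j$ satisfying $\alpha_E\circ s=s\circ\alpha$. It induces an $A$-bimodule structure on $(M,\alpha_M)$ by $\mu(a,m):=\mu_E(s(a),i(m))$ and $\mu(m,a):=\mu_E(i(m),s(a))$ (with $M$ identified with $i(M)$), which is independent of the choice of $s$. Two abelian extensions $(E,i,j,s)$ and $(E',i',j',s')$ of $A$ by $M$ are equivalent if there is a morphism of hom-associative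 algebras $\phi:E\to E'$ with $\phi\circ i=i'$ and $j'\circ\phi=j$ (no compatibility with $s,s'$ is required). *)

(* Defs.v *)
From HB Require Import structures.
From mathcomp Require Import all_boot all_algebra.
From mathcomp Require Import boolp functions.

Set Implicit Arguments.
Unset Strict Implicit.
Unset Printing Implicit Defensive.

Import GRing.Theory.
Local Open Scope ring_scope.
Local Open Scope quotient_scope.

(* Vector spaces are arbitrary [lmodType]s, not assumed finite dimensional. *)

Record homAssocAlg (K : fieldType) := HomAssocAlg {
  hom_car :> lmodType K;
  hmul : {bilinear hom_car -> hom_car -> hom_car};
  halpha : {linear hom_car -> hom_car};
  hom_assoc : forall a b c : hom_car,
    hmul (halpha a) (hmul b c) = hmul (hmul a b) (halpha c);
  hom_mult : forall a b : hom_car,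
    halpha (hmul a b) = hmul (halpha a) (halpha b) }.

Definition is_hom_morphism (K : fieldType) (A B : homAssocAlg K)
    (f : {linear A -> B}) : Prop :=
  (forall x y : A, f (hmul A x y) = hmul B (f x) (f y)) /\
  (forall x : A, f (halpha A x) = halpha B (f x)).

Record bimodule (K : fieldType) (A : homAssocAlg K) := Bimodule {
  bim_car :> lmodType K;
  balpha : {linear bim_car -> bim_car};
  lact : {bilinear A -> bim_car -> bim_car};
  ract : {bilinear bim_car -> A -> bim_car};
  lact_mult : forall (a : A) (m : bim_car),
    balpha (lact a m) = lact (halpha A a) (balpha m);
  lact_assoc : forall (a b : A) (m : bim_car),
    lact (halpha A a) (lact b m) = lact (hmul A a b) (balpha m);
  ract_mult : forall (m : bim_car) (a : A),
    balpha (ract m a) = ract (balpha m) (halpha A a);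
  ract_assoc : forall (m : bim_car) (a b : A),
    ract (ract m a) (halpha A b) = ract (balpha m) (hmul A a b);
  lract_assoc : forall (a : A) (m : bim_car) (b : A),
    lact (halpha A a) (ract m b) = ract (lact a m) (halpha A b) }.

Section Cohomology.
Variables (K : fieldType) (A : homAssocAlg K) (M : bimodule A).

Definition upd n (a : {ffun 'I_n -> A}) (i : 'I_n) (x : A) : {ffun 'I_n -> A} :=
  [ffun j => if j == i then x else a j].

Definition multilinear_map n (f : {ffun 'I_n -> A} -> M) : Prop :=
  forall (i : 'I_n) (a : {ffun 'I_n -> A}), linear (fun x : A => f (upd a i x)).

(* f \in C^n *)
Definition is_cochain n (f : {ffun 'I_n -> A} -> M) : Prop :=
  multilinear_map f /\
  forall a : {ffun 'I_n -> A}, balpha M (f a) = f [ffun j => halpha A (a j)].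

(* (alpha a_1, .., alpha a_(i-1), a_i a_(i+1), alpha a_(i+2), .., alpha a_(n+1)),
   with positions counted from 0. *)
Definition contract n (i : 'I_n) (a : {ffun 'I_n.+1 -> A}) : {ffun 'I_n -> A} :=
  [ffun j : 'I_n =>
     let a_j := a (widen_ord (leqnSn n) j) in
     let a_j1 := a (lift ord0 j) in
     if (j < i)%N then halpha A a_j
     else if j == i then hmul A a_j a_j1
     else halpha A a_j1].

(* Meaningful for n >= 1 only. The index i runs from 0, whence the sign
   (-1)^(i+1) in the sum. *)
Definition delta n (f : {ffun 'I_n -> A} -> M) : {ffun 'I_n.+1 -> A} -> M :=
  fun a =>
    lact M (iter n.-1 (halpha A) (a ord0)) (f [ffun j => a (lift ord0 j)])
    + \sum_(i < n) (-1) ^+ i.+1 *: f (contract i a)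
    + (-1) ^+ n.+1 *: ract M (f [ffun j => a (widen_ord (leqnSn n) j)])
                             (iter n.-1 (halpha A) (a ord_max)).

Definition is_cocycle n (f : {ffun 'I_n -> A} -> M) : Prop :=
  is_cochain f /\ delta f = 0.

(* The complex starts in degree 1, so that only 0 is a coboundary in degrees
   below 2. *)
Definition is_coboundary n : ({ffun 'I_n -> A} -> M) -> Prop :=
  match n with
  | m.+2 => fun f => exists2 g : {ffun 'I_m.+1 -> A} -> M,
                       is_cochain g & f = delta g
  | _ => fun f => f = 0
  end.

Lemma is_cochainB n (f g : {ffun 'I_n -> A} -> M) :
  is_cochain f -> is_cochain g -> is_cochain (f - g).
Proof.
move=> [fl fa] [gl ga]; split=> [i a k x y|a].
  have E h : is_cochain h -> h (upd a i (k *: x + y)) =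
      k *: h (upd a i x) + h (upd a i y) by move=> [hl _]; exact: hl.
  change (f (upd a i (k *: x + y)) - g (upd a i (k *: x + y)) =
    k *: (f (upd a i x) - g (upd a i x)) + (f (upd a i y) - g (upd a i y))).
  by rewrite !E // scalerBr opprD addrACA.
change (balpha M (f a - g a) =
  f [ffun j => halpha A (a j)] - g [ffun j => halpha A (a j)]).
by rewrite linearB fa ga.
Qed.

Lemma is_cochain0 n : is_cochain (0 : {ffun 'I_n -> A} -> M).
Proof.
split=> [i a k x y|a]; first by change (0 = k *: 0 + 0 :> M); rewrite scaler0 addr0.
by change (balpha M 0 = 0); rewrite linear0.
Qed.

Lemma deltaB n (f g : {ffun 'I_n -> A} -> M) : delta (f - g) = delta f - delta g.
Proof.
apply: funext => a.
change (delta (f - g) a = delta f a - delta g a); rewrite /delta.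
have E b : (f - g) b = f b - g b by [].
rewrite !E linearB linearBl scalerBr.
have -> : \sum_(i < n) (-1) ^+ i.+1 *: (f - g) (contract i a) =
    \sum_(i < n) (-1) ^+ i.+1 *: f (contract i a)
    - \sum_(i < n) (-1) ^+ i.+1 *: g (contract i a).
  by rewrite -sumrB; apply: eq_bigr => i _; rewrite E scalerBr.
by rewrite (addrACA (lact M _ _)) [LHS]addrACA !opprD.
Qed.

Lemma delta0 n : delta (0 : {ffun 'I_n -> A} -> M) = 0.
Proof. by rewrite -[X in delta X](subrr 0) deltaB subrr. Qed.

Definition cocycle_pred n : {pred ({ffun 'I_n -> A} -> M)} :=
  [pred f | `[< is_cocycle f >]].

Lemma cocycle_zmod_closed n : zmod_closed (@cocycle_pred n).
Proof.
split=> [|f g]; rewrite !inE.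
  by apply/asboolP; split; [exact: is_cochain0 | exact: delta0].
move=> /asboolP[fc fd] /asboolP[gc gd]; apply/asboolP; split.
  exact: is_cochainB.
by rewrite deltaB fd gd subrr.
Qed.

HB.instance Definition _ n :=
  GRing.isZmodClosed.Build ({ffun 'I_n -> A} -> M) (@cocycle_pred n)
    (cocycle_zmod_closed n).

Record cocycle n := Cocycle {
  cocycle_val :> {ffun 'I_n -> A} -> M;
  _ : cocycle_val \in @cocycle_pred n }.

HB.instance Definition _ n := [isSub for @cocycle_val n].
HB.instance Definition _ n := [Choice of cocycle n by <:].
HB.instance Definition _ n := [SubChoice_isSubZmodule of cocycle n by <:].

Definition coboundary_pred n : {pred (cocycle n)} :=
  [pred f : cocycle n | `[< is_coboundary (cocycle_val f) >]].

Lemma coboundary_zmod_closed n : zmod_closed (@coboundary_pred n).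
Proof.
split=> [|f g]; rewrite !inE.
  apply/asboolP; change (is_coboundary (0 : {ffun 'I_n -> A} -> M)).
  case: n => [|[|n]] //=; exists 0; [exact: is_cochain0 | by rewrite delta0].
move=> /asboolP fB /asboolP gB; apply/asboolP.
change (is_coboundary (cocycle_val f - cocycle_val g)).
move: (cocycle_val f) (cocycle_val g) fB gB => {f g}.
case: n => [|[|n]] /= f g; [by move=> -> ->; rewrite subrr.. |].
move=> [f' f'c ->] [g' g'c ->]; exists (f' - g'); first exact: is_cochainB.
by rewrite deltaB.
Qed.

HB.instance Definition _ n :=
  GRing.isZmodClosed.Build (cocycle n) (@coboundary_pred n)
    (coboundary_zmod_closed n).

(* ker delta / (ker delta :&: im delta), the image being in the kernel since
   delta \o delta = 0. *)
Definition cohomology n : zmodType := Quotient.quot (@coboundary_pred n).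

End Cohomology.

Section Extensions.
Variables (K : fieldType) (A : homAssocAlg K).

Section TrivialAlg.
Variables (V : lmodType K) (aV : {linear V -> V}).

Definition zero_mul (x y : V) : V := 0.

Lemma zero_mul_bilinear : bilinear_for *:%R *:%R zero_mul.
Proof. by split=> u k x y; rewrite /zero_mul /= scaler0 addr0. Qed.

HB.instance Definition _ :=
  bilinear_isBilinear.Build K V V V *:%R *:%R zero_mul zero_mul_bilinear.

Lemma zero_mul_assoc (a b c : V) :
  zero_mul (aV a) (zero_mul b c) = zero_mul (zero_mul a b) (aV c).
Proof. by []. Qed.

Lemma zero_mul_mult (a b : V) : aV (zero_mul a b) = zero_mul (aV a) (aV b).
Proof. exact: linear0. Qed.

Definition trivial_alg : homAssocAlg K :=
  @HomAssocAlg K V zero_mul aV zero_mul_assoc zero_mul_mult.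

End TrivialAlg.

(* [ext_s] is part of the data, but [ext_equiv] below ignores it. *)
Record abelian_ext (V : lmodType K) (aV : {linear V -> V}) := AbelianExt {
  ext_alg :> homAssocAlg K;
  ext_i : {linear trivial_alg aV -> ext_alg};
  ext_j : {linear ext_alg -> A};
  ext_s : {linear A -> ext_alg};
  ext_i_morph : is_hom_morphism ext_i;
  ext_j_morph : is_hom_morphism ext_j;
  ext_i_inj : injective ext_i;
  ext_exact : forall x : ext_alg, ext_j x = 0 <-> exists m, ext_i m = x;
  ext_j_surj : forall a : A, exists x, ext_j x = a;
  ext_sK : forall a : A, ext_j (ext_s a) = a;
  ext_s_alpha : forall a : A, halpha ext_alg (ext_s a) = ext_s (halpha A a) }.

Definition ext_equiv (V : lmodType K) (aV : {linear V -> V})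
    (E E' : abelian_ext aV) : Prop :=
  exists phi : {linear E -> E'},
    [/\ is_hom_morphism phi,
        forall m, phi (ext_i E m) = ext_i E' m &
        forall x, ext_j E' (phi x) = ext_j E x].

Definition induces (M : bimodule A) (E : abelian_ext (balpha M)) : Prop :=
  (forall (a : A) (m : M),
     hmul E (ext_s E a) (ext_i E m) = ext_i E (lact M a m)) /\
  (forall (a : A) (m : M),
     hmul E (ext_i E m) (ext_s E a) = ext_i E (ract M m a)).

Section Equivalence.
Variables (V : lmodType K) (aV : {linear V -> V}).
Implicit Types E F G : abelian_ext aV.

Lemma ext_equiv_refl E : ext_equiv E E.
Proof. by exists idfun. Qed.

Lemma ext_equiv_trans E F G : ext_equiv E F -> ext_equiv F G -> ext_equiv E G.
Proof.
move=> [f [[fM fa] fi fj]] [g [[gM ga] gi gj]]; exists (g \o f).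
split=> [|m|x] /=; [split=> [x y|x] /=| |].
- by rewrite fM gM.
- by rewrite fa ga.
- by rewrite fi gi.
- by rewrite gj fj.
Qed.

Lemma ext_equiv_sym E F : ext_equiv E F -> ext_equiv F E.
Proof.
move=> [f [[fM fa] fi fj]].
have f_inj : injective f.
  move=> x y fxy; apply/eqP; rewrite -subr_eq0; apply/eqP.
  have fxy0 : f (x - y) = 0 by rewrite linearB fxy subrr.
  have [m mE] : exists m, ext_i E m = x - y.
    by apply/ext_exact; rewrite -fj fxy0 linear0.
  rewrite -mE (_ : m = 0) ?linear0 //; apply: (@ext_i_inj _ _ F).
  by rewrite -fi mE fxy0 linear0.
have f_surj y : {x | f x = y}.
  apply: cid.
  have [m mE] : exists m, ext_i F m = y - f (ext_s E (ext_j F y)).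
    by apply/ext_exact; rewrite linearB fj ext_sK subrr.
  by exists (ext_i E m + ext_s E (ext_j F y)); rewrite linearD fi mE subrK.
pose g y := sval (f_surj y).
have gK : cancel g f by move=> y; rewrite /g; case: (f_surj y).
have fK : cancel f g by move=> x; apply: f_inj; rewrite gK.
have g_lin : linear g by move=> k x y; apply: f_inj; rewrite linearP !gK.
pose gL : {linear F -> E} :=
  HB.pack g (GRing.isLinear.Build K F E *:%R g g_lin).
exists gL; split=> [|m|x]; [split=> [x y|x]| |].
- by apply: f_inj; rewrite fM !gK.
- by apply: f_inj; rewrite fa !gK.
- by apply: f_inj; rewrite fi gK.
- by rewrite -fj gK.
Qed.

End Equivalence.

Section Ext.
Variable M : bimodule A.

Definition ext_over : Type := {E : abelian_ext (balpha M) | induces E}.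

Definition ext_class (E : ext_over) : ext_over -> Prop :=
  fun F => ext_equiv (sval E) (sval F).

(* [ext_over] quantifies over all [lmodType]s, hence is too large for the
   [{classic _}] choice structure that [{eq_quot _}] would need; the quotient is
   therefore the type of equivalence classes themselves, as predicates. *)
Definition Ext : Type :=
  {X : ext_over -> Prop | exists E : ext_over, X = ext_class E}.

End Ext.
End Extensions.

(* Main.v *)
Require Import Defs.
From HB Require Import structures.
From mathcomp Require Import all_boot all_algebra.
From mathcomp Require Import boolp functions.
Set Implicit Arguments.
Unset Strict Implicit.
Unset Printing Implicit Defensive.
Import GRing.Theory.
Local Open Scope ring_scope.

(** The classical correspondence between extensions and factor sets, with the
    structure maps carried along.

    A 2-cocycle [f] twists the product of the direct sum of [M] and [A] into
      [(m, a) (n, b) = (a n + m b + f (a, b), a b)].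
    The [M]-component of the hom-associativity of this product is, once the
    bimodule axioms are used, the equation [delta f = 0]; the multiplicativity
    of [alpha_M + alpha] is the condition that [f] commutes with the structure
    maps.  This gives an abelian extension [twisted_ext f].

    A morphism of extensions out of [twisted_ext f] is determined by its
    restriction to the summand [A], and this restriction is an equivariant
    section [t] of the target with [t a * t b = t (a b) + i (f (a, b))], that
    is, a section with factor set [f].  Conversely each such section comes from
    a morphism ([twisted_ext_equivP]).  The two halves of the bijection are
    special cases of this universal property.
    - Every extension is equivalent to a twisted one, because the factor set of
      its given section is a cocycle ([ext_factor_set]).
    - The equivariant sections of [twisted_ext g] are the maps [a |-> (h a, a)]
      with [h] a 1-cochain, and such a section has factor set [f] if and only if
      [f - g = delta h].  Hence [twisted_ext f] and [twisted_ext g] are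
      equivalent if and only if [f - g] is a coboundary
      ([twisted_ext_equiv_coboundary]). *)

(** * Cochains of degree one and two *)

Section LowDegree.
Variables (K : fieldType) (A : homAssocAlg K) (M : bimodule A).

Definition ffun1 (a : A) : {ffun 'I_1 -> A} := [ffun=> a].
Definition ffun2 (a b : A) : {ffun 'I_2 -> A} :=
  [ffun i => if i == ord0 then a else b].
Definition ffun3 (a b c : A) : {ffun 'I_3 -> A} :=
  [ffun i => if i == ord0 then a else if i == lift ord0 ord0 then b else c].

Lemma ffun1E (v : {ffun 'I_1 -> A}) : v = ffun1 (v ord0).
Proof. by apply/ffunP => i; rewrite ffunE (ord1 i). Qed.

Lemma ffun2E (v : {ffun 'I_2 -> A}) : v = ffun2 (v ord0) (v ord_max).
Proof.
apply/ffunP => i; rewrite ffunE.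
by case: (unliftP ord0 i) => [j|] -> //=; congr (v _); apply/val_inj; rewrite ord1.
Qed.

Lemma ffun3E (v : {ffun 'I_3 -> A}) :
  v = ffun3 (v ord0) (v (lift ord0 ord0)) (v ord_max).
Proof.
apply/ffunP => i; rewrite ffunE.
by case: i => [[|[|[|//]]] ?] /=; congr (v _); apply/val_inj.
Qed.

Definition cochain2 (f : {ffun 'I_2 -> A} -> M) (a b : A) : M := f (ffun2 a b).

Lemma delta1E (h : {ffun 'I_1 -> A} -> M) a b :
  cochain2 (delta h) a b =
  lact M a (h (ffun1 b)) - h (ffun1 (hmul A a b)) + ract M (h (ffun1 a)) b.
Proof.
rewrite /cochain2 /delta big_ord_recl big_ord0 addr0 /= !ffunE /=.
rewrite expr1 scaleN1r sqrrN expr1n scale1r.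
congr (lact M a (h _) - h _ + ract M (h _) b);
  by apply/ffunP => i; rewrite !ffunE (ord1 i).
Qed.

Lemma delta2E (f : {ffun 'I_2 -> A} -> M) a b c :
  delta f (ffun3 a b c) =
  lact M (halpha A a) (cochain2 f b c) - cochain2 f (hmul A a b) (halpha A c)
  + cochain2 f (halpha A a) (hmul A b c) - ract M (cochain2 f a b) (halpha A c).
Proof.
rewrite /cochain2 /delta !big_ord_recl big_ord0 addr0 /= !ffunE /=.
rewrite -signr_odd /= expr1 -[(-1) ^+ 2]signr_odd -[(-1) ^+ 3]signr_odd /=.
rewrite expr0 expr1 !scaleN1r scale1r addrA.
congr (lact M _ (f _) - f _ + f _ - ract M (f _) _);
  by apply/ffunP => i; rewrite !ffunE /=; case: i => [[|[|//]] ?] //=;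
     rewrite !ffunE.
Qed.

(** The form in which 2-cocycles are used and constructed below: the last
    identity is [delta f = 0] with each negative term moved to the other side,
    so that it matches the two ways to multiply three elements. *)
Lemma cocycle2P (f : {ffun 'I_2 -> A} -> M) :
  is_cocycle f <->
  [/\ bilinear_for *:%R *:%R (cochain2 f),
      forall a b, balpha M (cochain2 f a b) = cochain2 f (halpha A a) (halpha A b) &
      forall a b c,
        lact M (halpha A a) (cochain2 f b c)
          + cochain2 f (halpha A a) (hmul A b c) =
        ract M (cochain2 f a b) (halpha A c)
          + cochain2 f (hmul A a b) (halpha A c)].
Proof.
have upd0 a b x : upd (ffun2 a b) ord0 x = ffun2 x b.
  by apply/ffunP => i; rewrite !ffunE; case: eqP.
have upd1 a b x : upd (ffun2 a b) ord_max x = ffun2 a x.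
  by apply/ffunP => i; rewrite !ffunE; case: i => [[|[|//]] ?].
have alpha2 a b : [ffun j => halpha A (ffun2 a b j)] =
    ffun2 (halpha A a) (halpha A b).
  by apply/ffunP => i; rewrite !ffunE; case: eqP.
have delta2_eq0 a b c : delta f (ffun3 a b c) = 0 <->
    lact M (halpha A a) (cochain2 f b c) + cochain2 f (halpha A a) (hmul A b c) =
    ract M (cochain2 f a b) (halpha A c) + cochain2 f (hmul A a b) (halpha A c).
  rewrite delta2E (addrAC (lact M _ _)) -[X in X = 0]addrA -opprD.
  rewrite (addrC (cochain2 f (hmul _ _ _) _)).
  by split=> [/subr0_eq|->]; rewrite ?subrr.
split=> [[[flin fa] fd]|[[flinl flinr] fa fd]].
  split=> [|a b|a b c].
  - split=> [b k x y|a k x y].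
      by have := flin ord0 (ffun2 0 b) k x y; rewrite !upd0.
    by have := flin ord_max (ffun2 a 0) k x y; rewrite !upd1.
  - by rewrite /cochain2 fa alpha2.
  - by apply/delta2_eq0; rewrite fd.
split.
  split=> [i v k x y|v].
    rewrite (ffun2E v); case: (unliftP ord0 i) => [j|] ->.
      have -> : lift ord0 j = ord_max by apply/val_inj; rewrite (ord1 j).
      by rewrite !upd1; exact: flinr.
    by rewrite !upd0; exact: flinl.
  by rewrite (ffun2E v) alpha2; exact: fa.
by apply: funext => v; rewrite (ffun3E v); apply/delta2_eq0/fd.
Qed.

(** Replaces 1-cochains, functions of one-entry families, by equivariant linear
    maps on [A]. *)
Lemma coboundary2P (f : {ffun 'I_2 -> A} -> M) :
  is_coboundary f <->
  exists2 h : {linear A -> M},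
    forall a, balpha M (h a) = h (halpha A a) &
    forall a b, cochain2 f a b = lact M a (h b) - h (hmul A a b) + ract M (h a) b.
Proof.
have upd0 a x : upd (ffun1 a) ord0 x = ffun1 x.
  by apply/ffunP => i; rewrite !ffunE (ord1 i).
have alpha1 a : [ffun j => halpha A (ffun1 a j)] = ffun1 (halpha A a).
  by apply/ffunP => i; rewrite !ffunE.
split=> [[g [glin ga] ->]|[h ha fE]].
  pose h a := g (ffun1 a).
  have hlin : linear h.
    by move=> k x y; have := glin ord0 (ffun1 0) k x y; rewrite !upd0.
  pose hL : {linear A -> M} :=
    HB.pack h (GRing.isLinear.Build K A M *:%R h hlin).
  by exists hL => [a|a b]; [rewrite /= /h ga alpha1 | rewrite delta1E].
exists (fun v => h (v ord0)).
  split=> [i v k x y|v]; last by rewrite ffunE ha.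
  by rewrite (ord1 i) (ffun1E v) !upd0 !ffunE linearP.
apply: funext => v; rewrite (ffun2E v); have := fE (v ord0) (v ord_max).
rewrite /cochain2 => ->; have := delta1E (fun v => h (v ord0)) (v ord0) (v ord_max).
by rewrite /cochain2 !ffunE => ->.
Qed.

Lemma cocycleP (f : cocycle M 2) : is_cocycle f.
Proof. by case: f => f /= /asboolP. Qed.

End LowDegree.

(** * The extension defined by a cocycle *)

Section TwistedProduct.
Variables (K : fieldType) (A : homAssocAlg K) (M : bimodule A).
Variable f : cocycle M 2.

Let E : lmodType K := (M * A)%type.

Definition twisted_mul (x y : E) : E :=
  (lact M x.2 y.1 + ract M x.1 y.2 + cochain2 f x.2 y.2, hmul A x.2 y.2).

Lemma twisted_mul_bilinear : bilinear_for *:%R *:%R twisted_mul.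
Proof.
have [[flinl flinr] _ _] := (cocycle2P f).1 (cocycleP f).
split=> [[n b] k [m a] [m' a']|[m a] k [n b] [n' b']];
  congr (_, _); rewrite /= ?linearPl ?linearPr //=.
  by rewrite flinl !scalerDr (addrACA (_ *: _)) (addrACA (_ + _)).
by rewrite flinr !scalerDr (addrACA (_ *: _)) (addrACA (_ + _)).
Qed.

HB.instance Definition _ :=
  bilinear_isBilinear.Build K E E E *:%R *:%R twisted_mul twisted_mul_bilinear.

Definition twisted_alpha (x : E) : E := (balpha M x.1, halpha A x.2).

Lemma twisted_alpha_linear : linear twisted_alpha.
Proof. by move=> k x y; rewrite /twisted_alpha !linearP. Qed.

HB.instance Definition _ :=
  GRing.isLinear.Build K E E *:%R twisted_alpha twisted_alpha_linear.

(** The terms linear in an element of [M] agree by the three associativity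
    axioms of a bimodule; those containing [f] agree by the cocycle
    identity. *)
Lemma twisted_assoc (x y z : E) :
  twisted_mul (twisted_alpha x) (twisted_mul y z) =
  twisted_mul (twisted_mul x y) (twisted_alpha z).
Proof.
have [_ _ fd] := (cocycle2P f).1 (cocycleP f).
case: x y z => [m a] [n b] [p c]; congr (_, _); last exact: hom_assoc.
rewrite /= !linearDr !linearDl /= lact_assoc lract_assoc ract_assoc.
rewrite -!addrA; congr (_ + (_ + _)).
by rewrite addrCA fd.
Qed.

Lemma twisted_mult (x y : E) :
  twisted_alpha (twisted_mul x y) =
  twisted_mul (twisted_alpha x) (twisted_alpha y).
Proof.
have [_ fa _] := (cocycle2P f).1 (cocycleP f).
case: x y => [m a] [n b]; congr (_, _); last exact: hom_mult.
by rewrite /= !linearD /= lact_mult ract_mult fa.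
Qed.

Definition twisted_alg : homAssocAlg K :=
  @HomAssocAlg K E twisted_mul twisted_alpha twisted_assoc twisted_mult.

Definition twisted_i (m : M) : E := (m, 0).
Definition twisted_j (x : E) : A := x.2.
Definition twisted_s (a : A) : E := (0, a).

Lemma twisted_i_linear : linear twisted_i.
Proof. by move=> k x y; congr (_, _); rewrite /= scaler0 addr0. Qed.

Lemma twisted_j_linear : linear twisted_j.
Proof. by []. Qed.

Lemma twisted_s_linear : linear twisted_s.
Proof. by move=> k x y; congr (_, _); rewrite /= scaler0 addr0. Qed.

HB.instance Definition _ :=
  GRing.isLinear.Build K M E *:%R twisted_i twisted_i_linear.
HB.instance Definition _ :=
  GRing.isLinear.Build K E A *:%R twisted_j twisted_j_linear.
HB.instance Definition _ :=
  GRing.isLinear.Build K A E *:%R twisted_s twisted_s_linear.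

Lemma cochain2_0l a : cochain2 f 0 a = 0.
Proof.
have [[flinl _] _ _] := (cocycle2P f).1 (cocycleP f).
by have /= := flinl a (-1) 0 0; rewrite scaler0 addr0 scaleN1r addNr.
Qed.

Lemma cochain2_0r a : cochain2 f a 0 = 0.
Proof.
have [[_ flinr] _ _] := (cocycle2P f).1 (cocycleP f).
by have /= := flinr a (-1) 0 0; rewrite scaler0 addr0 scaleN1r addNr.
Qed.

Lemma twisted_i_morph :
  is_hom_morphism (twisted_i : {linear trivial_alg (balpha M) -> twisted_alg}).
Proof.
by split=> [x y|x]; congr (_, _);
  rewrite /= ?linear0l ?linear0r ?linear0 ?cochain2_0l ?addr0.
Qed.

Lemma twisted_j_morph : is_hom_morphism (twisted_j : {linear twisted_alg -> A}).
Proof. by []. Qed.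

Lemma twisted_i_inj : injective twisted_i.
Proof. by move=> x y []. Qed.

Lemma twisted_exact (x : E) : twisted_j x = 0 <-> exists m, twisted_i m = x.
Proof.
by case: x => m a; split=> [/= ->|[n [_ <-]]]; first by exists m.
Qed.

Lemma twisted_j_surj a : exists x, twisted_j x = a.
Proof. by exists (0, a). Qed.

Lemma twisted_s_alpha a : twisted_alpha (twisted_s a) = twisted_s (halpha A a).
Proof. by congr (_, _); exact: linear0. Qed.

Definition twisted_ext : abelian_ext A (balpha M) :=
  @AbelianExt K A M (balpha M) twisted_alg twisted_i twisted_j twisted_s
    twisted_i_morph twisted_j_morph twisted_i_inj twisted_exact twisted_j_surj
    (fun=> erefl) twisted_s_alpha.

Lemma twisted_induces : induces twisted_ext.
Proof.
by split=> a m; congr (_, _) => /=;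
  rewrite ?linear0l ?linear0r // ?cochain2_0l ?cochain2_0r ?addr0 ?add0r.
Qed.

Definition twisted_over : ext_over M := exist _ twisted_ext twisted_induces.

End TwistedProduct.

(** * Factor sets of extensions *)

Section Classification.
Variables (K : fieldType) (A : homAssocAlg K) (M : bimodule A).

(** The section [t] is arbitrary rather than [ext_s E], because an equivalence
    need not carry one chosen section to the other. *)
Definition section_with_factor_set (E : abelian_ext A (balpha M))
    (t : {linear A -> E}) (f : {ffun 'I_2 -> A} -> M) : Prop :=
  [/\ forall a, ext_j E (t a) = a,
      forall a, halpha E (t a) = t (halpha A a) &
      forall a b, hmul E (t a) (t b) = t (hmul A a b) + ext_i E (cochain2 f a b)].

(** The induced bimodule structure does not depend on the section: two sections
    differ by elements of the image of [M], and these multiply [M] to zero. *)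
Lemma section_action (E : abelian_ext A (balpha M)) (t : {linear A -> E}) :
  induces E -> (forall a, ext_j E (t a) = a) ->
  (forall a m, hmul E (t a) (ext_i E m) = ext_i E (lact M a m)) /\
  (forall a m, hmul E (ext_i E m) (t a) = ext_i E (ract M m a)).
Proof.
move=> [Hl Hr] tK.
have tE a : exists n, t a = ext_s E a + ext_i E n.
  have [n nE] : exists n, ext_i E n = t a - ext_s E a.
    by apply/ext_exact; rewrite linearB tK ext_sK subrr.
  by exists n; rewrite nE addrC subrK.
have ii0 m n : hmul E (ext_i E m) (ext_i E n) = 0.
  by rewrite -(ext_i_morph E).1 linear0.
split=> a m; have [n ->] := tE a.
  by rewrite linearDl /= Hl ii0 addr0.
by rewrite linearDr /= Hr ii0 addr0.
Qed.

(** In one direction [t] is the restriction of the equivalence to the summand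
    [A]; in the other, [(m, a) |-> i m + t a] is the equivalence, which
    is multiplicative because [t] induces the given actions on [M]. *)
Lemma twisted_ext_equivP (f : cocycle M 2) (E : abelian_ext A (balpha M)) :
  induces E ->
  ext_equiv (twisted_ext f) E <->
  exists t : {linear A -> E}, section_with_factor_set t f.
Proof.
move=> EM; split=> [[phi [[phiM phia] phii phij]]|[t [tK ta tM]]].
  exists (phi \o (@twisted_s K A M)); split=> [a|a|a b] /=.
  - by rewrite phij.
  - by rewrite -phia; congr (phi _); exact: twisted_s_alpha.
  - rewrite -phiM -phii -linearD; congr (phi _); congr (_, _) => /=.
      by rewrite linear0r linear0l addr0.
    by rewrite addr0.
have [Hl Hr] := section_action EM tK.
pose phi (x : twisted_ext f) : E := ext_i E x.1 + t x.2.
have phi_lin : linear phi.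
  by move=> k x y; rewrite /phi !linearP scalerDr addrACA.
pose phiL : {linear twisted_ext f -> E} :=
  HB.pack phi (GRing.isLinear.Build K (twisted_ext f) E *:%R phi phi_lin).
exists phiL; split=> [|m|[m a]]; first split=> [[m a] [n b]|[m a]];
  rewrite /= /phi /=.
- rewrite !linearDl !linearDr /= Hl Hr -(ext_i_morph E).1 linear0 add0r tM.
  by rewrite !linearD /= -!addrA addrCA; congr (_ + (_ + _)); rewrite addrC.
- by rewrite linearD /= ta -(ext_i_morph E).2.
- by rewrite linear0 addr0.
- by rewrite linearD /= tK (ext_exact _).2 ?add0r //; exists m.
Qed.

(** The factor set measures the failure of the section to be multiplicative, so
    it takes values in the kernel of [j].  Its cocycle identity is the
    hom-associativity of [E] on three elements of the section. *)
Lemma ext_factor_set (E : abelian_ext A (balpha M)) :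
  induces E -> exists f : cocycle M 2, section_with_factor_set (ext_s E) f.
Proof.
move=> [Hl Hr].
have fP a b : {m | ext_i E m =
    hmul E (ext_s E a) (ext_s E b) - ext_s E (hmul A a b)}.
  by apply: cid; apply/ext_exact;
    rewrite linearB /= (ext_j_morph E).1 !ext_sK subrr.
pose g a b := sval (fP a b).
have gE a b : hmul E (ext_s E a) (ext_s E b) =
    ext_s E (hmul A a b) + ext_i E (g a b).
  by rewrite /g; case: (fP a b) => m /= ->; rewrite addrC subrK.
pose f (v : {ffun 'I_2 -> A}) := g (v ord0) (v ord_max).
have fE a b : cochain2 f a b = g a b by rewrite /cochain2 /f !ffunE.
have ig a b : ext_i E (g a b) =
    hmul E (ext_s E a) (ext_s E b) - ext_s E (hmul A a b).
  by rewrite gE addrC addKr.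
have fc : is_cocycle f.
  apply/cocycle2P; split=> [|a b|a b c].
  - split=> [b k x y|a k x y]; rewrite !fE; apply: (@ext_i_inj _ _ _ _ E).
      by rewrite linearP !ig linearP !linearPl /= linearP scalerBr opprD addrACA.
    by rewrite linearP !ig linearP !linearPr /= linearP scalerBr opprD addrACA.
  - rewrite !fE; apply: (@ext_i_inj _ _ _ _ E); rewrite (ext_i_morph E).2 !ig.
    by rewrite linearB /= hom_mult !ext_s_alpha hom_mult.
  - rewrite !fE; apply: (@ext_i_inj _ _ _ _ E).
    have := hom_assoc (ext_s E a) (ext_s E b) (ext_s E c).
    rewrite !gE !linearDl !linearDr /= !ext_s_alpha Hl Hr !gE hom_assoc.
    rewrite -!addrA !linearD => /addrI; rewrite addrC => ->.
    by rewrite addrC.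
have fin : f \in @cocycle_pred _ _ M 2 by apply/asboolP.
exists (Cocycle fin); split=> [a|a|a b] /=; first exact: ext_sK.
  exact: ext_s_alpha.
by rewrite gE fE.
Qed.

(** Sections of [twisted_ext g] are graphs of linear maps [h : A -> M], and
    [mulE] says that the graph of [h] has factor set [f] exactly when [delta h]
    is [f - g]. *)
Lemma twisted_ext_equiv_coboundary (f g : cocycle M 2) :
  ext_equiv (twisted_ext f) (twisted_ext g) <->
  is_coboundary (cocycle_val (f - g)).
Proof.
have subE a b : cochain2 (cocycle_val (f - g)) a b =
    cochain2 f a b - cochain2 g a b by [].
have mulE (h : {linear A -> M}) a b :
    hmul (twisted_ext g) (h a, a) (h b, b) =
      (h (hmul A a b), hmul A a b) + ext_i (twisted_ext g) (cochain2 f a b) <->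
    cochain2 (cocycle_val (f - g)) a b =
      lact M a (h b) - h (hmul A a b) + ract M (h a) b.
  have key : lact M a (h b) + ract M (h a) b + cochain2 g a b = h (hmul A a b) +
      (lact M a (h b) - h (hmul A a b) + ract M (h a) b + cochain2 g a b).
    by rewrite (addrAC (lact M _ _) (- _)) (addrAC (_ + _) (- _)) subrKC.
  (* The second components always agree; only the first carries information. *)
  rewrite subE; split=> [/(congr1 fst) /= fE|/eqP].
    apply/eqP; rewrite subr_eq; apply/eqP/(addrI (h (hmul A a b))).
    by rewrite -key -fE.
  rewrite subr_eq => /eqP ->; congr (_, _); last by rewrite /= addr0.
  exact: key.
apply: iff_trans (twisted_ext_equivP _ (twisted_induces g)) _.
apply: iff_trans _ (iff_sym (coboundary2P _)); split=> [[t [tK ta tM]]|[h ha hM]].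
  have tE a : t a = ((t a).1, a) by rewrite -[X in (_, X)](tK a); case: (t a).
  exists (fst \o t) => [a|a b]; first by rewrite /= -ta.
  by apply/(mulE (fst \o t)); rewrite /= -!tE tM.
pose t a : twisted_ext g := (h a, a).
have tlin : linear t by move=> k x y; rewrite /t linearP.
pose tL : {linear A -> twisted_ext g} :=
  HB.pack t (GRing.isLinear.Build K A (twisted_ext g) *:%R t tlin).
exists tL; split=> [a|a|a b] //=; first by congr (_, _); exact: ha.
exact/mulE.
Qed.

Lemma ext_class_eq (E F : ext_over M) :
  ext_class E = ext_class F <-> ext_equiv (sval E) (sval F).
Proof.
split=> [EF|EF].
  have : ext_class F F by exact: ext_equiv_refl.
  by rewrite -EF; exact.
apply: funext => G; apply: propext; split; apply: ext_equiv_trans => //.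
exact: ext_equiv_sym.
Qed.

End Classification.

(** * The bijection *)

Theorem theorem3p3 (K : fieldType) (charK : [pchar K] =i pred0)
    (A : homAssocAlg K) (M : bimodule A) :
  exists F : cohomology M 2 -> Ext M, bijective F.
Proof.
pose F (c : cohomology M 2) : Ext M :=
  exist _ (ext_class (twisted_over (repr c))) (ex_intro _ _ erefl).
have F_inj : injective F.
  move=> c d /(congr1 sval) /ext_class_eq /twisted_ext_equiv_coboundary cd.
  rewrite -(reprK c) -(reprK d); apply/eqP; rewrite -Quotient.idealrBE.
  exact/asboolP.
have F_surj X : exists c, F c = X.
  case: X => X [E XE]; case: (ext_factor_set (svalP E)) => f fE.
  exists (\pi f)%qT; apply: eq_exist; rewrite XE; apply/ext_class_eq.
  apply: (@ext_equiv_trans _ _ _ _ _ (twisted_ext f)); last first.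
    by apply/twisted_ext_equivP; [exact: svalP | exists (ext_s (sval E))].
  (* The representative of the class of f differs from f by a coboundary. *)
  apply/twisted_ext_equiv_coboundary.
  have : (repr (\pi_(cohomology M 2) f) == f %[mod cohomology M 2])%qT.
    by rewrite reprK.
  by rewrite -Quotient.idealrBE => /asboolP.
pose G X := sval (cid (F_surj X)).
have GK : cancel G F by move=> X; rewrite /G; case: (cid _).
by exists F; exists G => // c; apply: F_inj; rewrite GK.
Qed.
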